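(* Let $A$ be a finite set with $|A|\ge2$ and let $n\ge2$. Let $\phi:[n]\to[n]$ be a transformation with $F$ fixed points. Then the manipulation of variables $f^\phi:A^n\to A^n$ can be computed with one memory cell in at most $n-F+1$ instructions, i.e. $\mathcal{L}(f^\phi|1)\le n-F+1$.
   Context: $[n]=\{1,\dots,n\}$; the image of $i$ under $\phi:[n]\to[n]$ is written $i\phi$. The manipulation of variables induced by $\phi$ is $f^\phi(x_1,\dots,x_n)=(x_{1\phi},\dots,x_{n\phi})$. For $N\ge1$, a transformation of $A^N$ is a map $h=(h_1,\dots,h_N):A^N\to A^N$; its coordinate function $h_i:A^N\to A$ is trivial if $h_i(x)=x_i$ for all $x$. An instruction of $A^N$ is a transformation of $A^N$ with at most one nontrivial coordinate function. A program of length $L$ computing $h$ is a sequence of instructions $g^1,\dots,g^L$ of $A^N$ with $h=g^L\circ\cdots\circ g^1$. The procedural complexity $\mathcal{L}(h)$ is the shortest length of a program computing $h$; the identity has procedural complexity $0$. For a transformation $f$ of $A^n$, $D(f,m)$ is the set of transformations $h$ of $A^{n+m}$ such that $h_i(x_1,\dots,x_{n+m})=f_i(x_1,\dots,x_n)$ for all $1\le i\le n$ and all $(x_1,\dots,x_{n+m})\in A^{n+m}$. The shortest length of a program computing $f$ using $m$ memory cells is $\mathcal{L}(f|m):=\min_{h\in D(f,m)}\mathcal{L}(h)$. *)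

(* Defs.v *)
From mathcomp Require Import all_boot all_fingroup.

Set Implicit Arguments.
Unset Strict Implicit.
Unset Printing Implicit Defensive.

(* [(A ^ N)%type] is the library's notation for [{ffun 'I_N -> A}]; the index
   set {1, ..., N} is represented by ['I_N] = {0, ..., N - 1}. *)
Notation transformation A N := {ffun (A ^ N)%type -> (A ^ N)%type}.

Definition trivial_coord (A : finType) (N : nat) (h : transformation A N)
    (i : 'I_N) : bool :=
  [forall x : (A ^ N)%type, h x i == x i].

Definition instruction (A : finType) (N : nat) (h : transformation A N) : bool :=
  #|[set i | ~~ trivial_coord h i]| <= 1.

(* The instructions are listed in order of execution:
   [run [:: g1; ...; gL] x = gL (... (g1 x))]. *)
Definition run (A : finType) (N : nat) (p : seq (transformation A N))
    (x : (A ^ N)%type) : (A ^ N)%type :=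
  foldl (fun y (g : transformation A N) => g y) x p.

Definition computes (A : finType) (N : nat) (p : seq (transformation A N))
    (h : transformation A N) : bool :=
  all (@instruction A N) p && [forall x, run p x == h x].

Definition computable_in (A : finType) (N : nat) (h : transformation A N)
    (L : nat) : bool :=
  [exists p : L.-tuple (transformation A N), computes p h].

(* Every transformation is computed by some program, so that the procedural
   complexity is a minimum over a nonempty set. *)
Section Universality.

Variables (A : finType) (N : nat).
Implicit Types (x y z : (A ^ N)%type) (h : (A ^ N)%type -> (A ^ N)%type).

Let prog h := exists2 p : seq (transformation A N),
  all (@instruction A N) p & run p =1 h.

Let prog_ext h h' : h =1 h' -> prog h -> prog h'.
Proof. by move=> e [p ip rp]; exists p => // x; rewrite rp e. Qed.

Let prog_id : prog id.
Proof. by exists [::]. Qed.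

Let prog_comp h h' : prog h -> prog h' -> prog (h' \o h).
Proof.
move=> [p ip rp] [q iq rq]; exists (p ++ q); first by rewrite all_cat ip.
by move=> x; rewrite /run foldl_cat -/(run p x) rp -/(run q _) rq.
Qed.

Let prog_instr h i : (forall x j, j != i -> h x j = x j) -> prog h.
Proof.
move=> hP; exists [:: finfun h]; last by move=> x; rewrite /run /= ffunE.
rewrite /= andbT /instruction -(cards1 i); apply/subset_leq_card/subsetP => j.
rewrite !inE; apply: contraNT => ji.
by apply/forallP => x; rewrite ffunE hP.
Qed.

Let assign x y z := if z == x then y else z.

Let dist x y := #|[set i | x i != y i]|.

Let conj_ind (u : (A ^ N)%type -> (A ^ N)%type -> (A ^ N)%type -> (A ^ N)%type) :
  (forall x, u x x =1 id) ->
  (forall x y i, (forall j, j != i -> x j = y j) -> prog (u x y)) ->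
  (forall x y z, z != x -> y != x ->
     prog (tperm z y) -> prog (u x z) -> prog (u x y)) ->
  (forall x y, prog (u x y) -> prog (tperm x y)) ->
  forall d x y, dist x y < d -> prog (u x y).
Proof.
move=> u_id u_nb u_conj ut; elim=> // d IHd x y.
rewrite ltnS => dxy.
have [->|xy] := eqVneq x y; first by apply: prog_ext prog_id => z; rewrite u_id.
have /existsP[i xyi] : [exists i, x i != y i].
  apply: contraNT xy; rewrite negb_exists => /forallP e.
  by apply/eqP/ffunP => i; have := e i; rewrite negbK => /eqP.
pose z : (A ^ N)%type := [ffun j => if j == i then y i else x j].
have zi : z i = y i by rewrite ffunE eqxx.
have zx : z != x by apply: contraNneq xyi => <-; rewrite zi.
have dzy : dist z y < d.
  apply: leq_trans dxy; apply/proper_card/properP; split.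
    apply/subsetP => j; rewrite !inE ffunE.
    by have [->|//] := eqVneq j i; rewrite eqxx.
  by exists i; rewrite !inE ?zi ?eqxx.
apply: (u_conj x y z) => //; first by rewrite eq_sym.
- exact: ut (IHd z y dzy).
- by apply: (u_nb x z i) => j ji; rewrite ffunE (negPf ji).
Qed.

Let prog_tperm x y : prog (tperm x y).
Proof.
apply: (conj_ind (u := fun x y => tperm x y)) (ltnSn (dist x y)).
- by move=> a z; rewrite tperm1 perm1.
- move=> a b i ab; apply: (prog_instr (i := i)) => z j ji.
  by case: tpermP => // ->; rewrite ab.
- move=> a b c ca ba cb ac.
  apply: prog_ext (prog_comp (prog_comp cb ac) cb) => z /=.
  have [<-|cb'] := eqVneq c b; first by rewrite tperm1 !perm1.
  rewrite -!permM; congr (fun_of_perm _ z).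
  have := tpermJ a c (tperm c b).
  by rewrite tpermL (tpermD ca ba) conjgE tpermV mulgA => ->.
- by [].
Qed.

Let prog_assign x y : prog (assign x y).
Proof.
apply: (conj_ind (u := assign)) (ltnSn (dist x y)).
- by move=> a z; rewrite /assign; case: eqP.
- move=> a b i ab; apply: (prog_instr (i := i)) => z j ji.
  by rewrite /assign; case: eqP => // ->; rewrite ab.
- move=> a b c ca ba cb ac.
  apply: prog_ext (prog_comp (prog_comp cb ac) cb) => z /=.
  rewrite /assign -(inj_eq (@perm_inj _ (tperm c b)) z) (tpermD ca ba).
  by case: eqP; rewrite ?tpermL ?tpermK.
- by move=> *; apply: prog_tperm.
Qed.

Let prog_all h : prog h.
Proof.
have [d] := ubnP #|[predC codom h]|; elim: d h => // d IHd h /ltnSE le_d.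
have [/injectiveP inj_h|] := boolP (injectiveb h).
  apply: (prog_ext (h := perm inj_h)) => [x|]; first by rewrite permE.
  have [ts -> _] := prod_tpermP (perm inj_h).
  elim: ts => [|t ts IH].
    by rewrite big_nil; apply: prog_ext prog_id => x; rewrite perm1.
  rewrite big_cons; apply: prog_ext (prog_comp (prog_tperm t.1 t.2) IH) => x.
  by rewrite /= permM.
case/injectivePn => a [b ab hab].
have [c c_h] : exists c, c \notin codom h.
  apply/existsP; apply: contraNT ab; rewrite negb_exists => /forallP h_onto.
  have: injectiveb h.
    rewrite /injectiveb /dinjectiveb -/(codom h); apply/card_uniqP.
    rewrite size_codom; apply: eq_card => z.
    by have := h_onto z; rewrite negbK inE => ->.
  by move/injectiveP => h_inj; apply/eqP/h_inj.
pose h' x := if x == b then c else h x.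
have ph' : prog h'.
  apply: IHd; apply: leq_trans le_d; apply/proper_card/properP; split.
    apply/subsetP => z; rewrite !inE; apply: contraNN => /codomP[x ->].
    have [->|xb] := eqVneq x b; last by apply/codomP; exists x; rewrite /h' (negPf xb).
    by apply/codomP; exists a; rewrite /h' (negPf ab) hab.
  exists c; first by rewrite !inE.
  by rewrite !inE negbK; apply/codomP; exists b; rewrite /h' eqxx.
apply: prog_ext (prog_comp ph' (prog_assign c (h b))) => x /=.
rewrite /assign /h'; have [->|_] := eqVneq x b; first by rewrite eqxx.
by case: eqP => // hx; case/negP: c_h; rewrite -hx codom_f.
Qed.

Lemma computable_transformation (h : transformation A N) :
  exists L, computable_in h L.
Proof.
have [p ip rp] := prog_all h; exists (size p).
apply/existsP; exists (in_tuple p); rewrite /computes ip.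
by apply/forallP => x; rewrite rp.
Qed.

End Universality.

Definition procedural_complexity (A : finType) (N : nat)
    (h : transformation A N) : nat :=
  ex_minn (computable_transformation h).

Definition prefix_point (A : finType) (n m : nat) (x : (A ^ (n + m))%type) :
    (A ^ n)%type :=
  [ffun i => x (lshift m i)].

Definition extensions (A : finType) (n : nat) (f : transformation A n) (m : nat) :
    {set transformation A (n + m)} :=
  [set h : transformation A (n + m) |
     [forall x, forall i : 'I_n, h x (lshift m i) == f (prefix_point x) i]].

Lemma extensions_complexity (A : finType) (n : nat) (f : transformation A n)
    (m : nat) :
  exists L, [exists h in extensions f m, procedural_complexity h == L].
Proof.
pose h : transformation A (n + m) := [ffun x : (A ^ (n + m))%type =>
  [ffun k => match split k with
             | inl i => f (prefix_point x) i
             | inr _ => x k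
             end]].
exists (procedural_complexity h); apply/existsP; exists h; rewrite eqxx andbT inE.
by apply/forallP => x; apply/forallP => i; rewrite !ffunE (unsplitK (inl i)).
Qed.

Definition memory_complexity (A : finType) (n : nat) (f : transformation A n)
    (m : nat) : nat :=
  ex_minn (extensions_complexity f m).

Definition manipulation (A : finType) (n : nat) (phi : 'I_n -> 'I_n) :
    transformation A n :=
  [ffun x : (A ^ n)%type => [ffun i => x (phi i)]].

(* Main.v *)
Require Import Defs.
From mathcomp Require Import all_boot.
From mathcomp Require Import ssralg zmodp.

Set Implicit Arguments.
Unset Strict Implicit.
Unset Printing Implicit Defensive.

(** One instruction stores in the memory cell the sum (for a group structure on
    [A]) of one representative register of each nontrivial cycle of [phi]; then
    every register that is not fixed is updated exactly once. A register outside
    the set of representatives is updated once all the registers that need it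
    have been, and a new cycle is opened at its representative only when the
    previous ones are closed. Thus at most one representative has a value that
    is no longer present in some register, and that value is recovered from the
    sum. *)

(** * Cycles of a transformation and the order of the updates *)

Section CycleRepresentatives.

Variables (T : finType) (f : T -> T).
Implicit Types (x y c d i : T) (S : {set T}).

Definition moved : {set T} := [set i | f i != i].

(** Since [f] need not be injective, [fconnect] is only forward reachability: the second condition
    says that [c] is periodic, and [froot], constant on each cycle, selects one point per cycle. *)
Definition cycle_reps : {set T} :=
  [set c in moved | fconnect f (f c) c & froot f c == c].

Lemma fconnect_periodic_sym x y :
  fconnect f (f x) x -> fconnect f x y -> fconnect f y x.
Proof.
move=> fx /iter_findex <-; elim: (findex f x y) => [|k IHk] /=; first exact: connect0.
by move: IHk; rewrite fconnect_eqVf => /predU1P[->|].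
Qed.

Lemma froot_eq x y : fconnect f x y -> fconnect f y x -> froot f x = froot f y.
Proof.
move=> xy yx; rewrite /root.
have /eq_pick-> : fconnect f x =1 fconnect f y.
  by move=> z; apply/idP/idP; apply: connect_trans.
by case: pickP => // /(_ y); rewrite connect0.
Qed.

Lemma cycle_reps_inj c d :
  c \in cycle_reps -> d \in cycle_reps -> fconnect f c d -> c = d.
Proof.
rewrite !inE => /and3P[_ fc /eqP rc] /and3P[_ _ /eqP rd] cd.
by rewrite -rc -rd; apply: froot_eq; last exact: fconnect_periodic_sym.
Qed.

Lemma cycle_reps_preim c : c \in cycle_reps -> exists2 p, p \in moved & f p = c.
Proof.
rewrite !inE => /and3P[fc /iter_findex e _].
have fp : f (iter (findex f (f c) c) f c) = c by rewrite -iterS iterSr.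
exists (iter (findex f (f c) c) f c) => //; rewrite inE fp.
by apply: contraNneq fc => cE; rewrite {1}cE fp.
Qed.

(* If the set [U] of the ancestors of [i] in [S] contained no representative, each
   of its points would have a preimage in it, so that [f @: U = U]: the forward
   orbit of [i] would consist of ancestors of [i], hence be a cycle inside [S]. *)
Lemma backward_cycle_rep S i :
  S \subset moved ->
  (forall j, j \in S -> j \notin cycle_reps -> exists2 k, k \in S & f k = j) ->
  i \in S -> exists2 c, c \in cycle_reps :&: S & fconnect f c i.
Proof.
move=> /subsetP Smoved preS iS.
have [/exists_inP[c cS ci]|] := boolP [exists c in cycle_reps :&: S, fconnect f c i].
  by exists c.
rewrite negb_exists => /forallP noC.
pose U := [set j in S | fconnect f j i].
have sub : U \subset f @: U.
  apply/subsetP => j; rewrite inE => /andP[jS ji].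
  have jC : j \notin cycle_reps.
    by have := noC j; rewrite inE jS ji !andbT.
  have [k kS kj] := preS j jS jC; rewrite -kj imset_f // inE kS /=.
  by apply: connect_trans (fconnect1 f k) _; rewrite kj.
have imU : f @: U = U by apply/esym/eqP; rewrite eqEcard sub leq_imset_card.
have fU j : j \in U -> f j \in U by move=> jU; rewrite -imU imset_f.
have iU : i \in U by rewrite inE iS connect0.
have dU : froot f i \in U.
  have := connect_root (frel f) i => /iter_findex <-.
  by elim: (findex _ _ _) => //= k /fU.
set d := froot f i in dU.
have id_ : fconnect f i d by exact: connect_root.
have := dU; rewrite inE => /andP[dS di].
exists d => //; rewrite !inE dS andbT; apply/and3P; split.
- by have := Smoved d dS; rewrite inE.
- have := fU d dU; rewrite inE => /andP[_ fdi].
  exact: connect_trans fdi id_.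
- by rewrite -(froot_eq id_ di).
Qed.

(* [S] is the set of the registers already updated: [j] is lost when its
   initial value is no longer in any register. *)
Definition lost S j := (j \in S) && [forall k in S, f k != j].

(** By the second clause, a register that is not a representative is overwritten only after its
    readers, so only representatives can be lost; the third leaves at most one for the checksum to
    recover. *)
Definition admissible S :=
  [/\ S \subset moved,
      forall i k, i \in S -> i \notin cycle_reps -> f k = i -> k \in S &
      forall c d, c \in cycle_reps -> d \in cycle_reps ->
        lost S c -> lost S d -> c = d].

Lemma admissible0 : admissible set0.
Proof.
split=> [|i k|c d _ _]; [exact: sub0set | by rewrite inE | by rewrite /lost inE].
Qed.

Lemma lost_setU1 S i c : lost (i |: S) c -> c = i \/ lost S c.
Proof.
case/andP; rewrite in_setU1 => /predU1P[->|cS] /forall_inP fk; [by left | right].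
by rewrite /lost cS; apply/forall_inP => k kS; apply: fk; rewrite in_setU1 kS orbT.
Qed.

(** If no remaining nonrepresentative has all its readers updated, every remaining register can be
    traced back to a remaining representative. Then no representative is lost, and updating a
    remaining one loses at most that one. *)
Lemma admissible_step S :
  admissible S -> S != moved ->
  exists2 i, i \in moved :\: S & admissible (i |: S).
Proof.
move=> [Sm closedS lostS] SNm.
have Sub1 i : i \in moved :\: S -> i |: S \subset moved.
  by rewrite inE => /andP[_ im]; rewrite subUset sub1set im.
have [/exists_inP[i iD /andP[iC /forall_inP pre_i]]|] := boolP
  [exists i in moved :\: S,
     (i \notin cycle_reps) && [forall (k | f k == i), k \in S]].
  exists i => //; split; first exact: Sub1.
    move=> j k; rewrite !in_setU1 => /predU1P[->|jS] jC fk.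
      by rewrite pre_i ?orbT //; apply/eqP.
    by rewrite (closedS j k) ?orbT.
  move=> c d cC dC /lost_setU1[ci|lc]; first by rewrite -ci cC in iC.
  by case/lost_setU1 => [di|]; [rewrite -di dC in iC | apply: lostS].
rewrite negb_exists => /forallP noFree.
have back i : i \in moved :\: S ->
    exists2 c, c \in cycle_reps :&: (moved :\: S) & fconnect f c i.
  apply: backward_cycle_rep => [|j jD jC]; first exact: subsetDl.
  have := noFree j; rewrite jD jC /= negb_forall => /existsP[k].
  rewrite negb_imply => /andP[/eqP kj kS]; exists k => //.
  rewrite inE kS inE kj; apply: contraNneq kS => jk.
  by move: jD; rewrite !inE {2}jk kj eqxx andbF.
(* The predecessor of a lost [c] on its cycle is not updated yet; tracing it back gives a remaining
   representative that leads to [c], hence equals [c], although [c] is in [S]. *)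
have no_lost c : c \in cycle_reps -> ~~ lost S c.
  move=> cC; apply/negP => /andP[cS /forall_inP fk].
  have [p pm pc] := cycle_reps_preim cC.
  have pD : p \in moved :\: S.
    by rewrite inE pm andbT; apply/negP => /fk; rewrite pc eqxx.
  have [d] := back p pD; rewrite inE => /andP[dC dD] dp.
  have dc : d = c.
    apply: cycle_reps_inj => //; apply: connect_trans dp _.
    by rewrite -pc fconnect1.
  by move: dD; rewrite dc inE cS.
have [i iD] : exists i, i \in moved :\: S.
  by apply/set0Pn; apply: contra SNm; rewrite setD_eq0 eqEsubset Sm.
have [c] := back i iD; rewrite inE => /andP[cC cD] _.
exists c => //; split; first exact: Sub1.
  move=> j k; rewrite !in_setU1 => /predU1P[->|jS] jC fk; first by rewrite cC in jC.
  by rewrite (closedS j k) ?orbT.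
move=> a b aC bC /lost_setU1[->|la]; last by have := no_lost a aC; rewrite la.
by case/lost_setU1 => [->|lb] //; have := no_lost b bC; rewrite lb.
Qed.

End CycleRepresentatives.

(** * Complexity bounds from explicit programs *)

Section Complexity.

Variable A : finType.

Lemma procedural_complexity_le N (p : seq (transformation A N)) h :
  computes p h -> procedural_complexity h <= size p.
Proof.
move=> ph; rewrite /procedural_complexity; case: ex_minnP => L _; apply.
by apply/existsP; exists (in_tuple p).
Qed.

Lemma memory_complexity_le n m (f : transformation A n) h :
  h \in extensions f m -> memory_complexity f m <= procedural_complexity h.
Proof.
move=> hf; rewrite /memory_complexity; case: ex_minnP => L _; apply.
by apply/exists_inP; exists h.
Qed.

(** An instruction sees the current state [u x], not the input [x]; the second hypothesis makes the
    new value of register [k] a function of that state. Outside the image of [u], the identity is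
    taken. *)
Lemma exists_instruction N (X : finType) (u v : X -> (A ^ N)%type) (k : 'I_N) :
  (forall x j, j != k -> v x j = u x j) ->
  (forall x y, u x = u y -> v x k = v y k) ->
  exists2 g : transformation A N, instruction g & forall x, g (u x) = v x.
Proof.
move=> vu vk.
exists [ffun z => if [pick x | u x == z] is Some x then v x else z].
  rewrite /instruction -(cards1 k); apply/subset_leq_card/subsetP => j.
  rewrite !inE; apply: contraNT => jk; apply/forallP => z; rewrite ffunE.
  by case: pickP => [x /eqP <-|_] //; rewrite vu.
move=> x; rewrite ffunE; case: pickP => [y /eqP uyx|/(_ x)]; last by rewrite eqxx.
apply/ffunP => j; have [->|jk] := eqVneq j k; first exact: vk.
by rewrite !vu // uyx.
Qed.

End Complexity.

(** * A checksum that recovers one missing value *)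

Section Checksum.

Import GRing.Theory.
Local Open Scope ring_scope.

Lemma exists_checksum (A I : finType) (C : {set I}) : (0 < #|A|)%N ->
  exists M : (I -> A) -> A, forall x y c, c \in C -> M x = M y ->
    (forall d, d \in C -> d != c -> x d = y d) -> x c = y c.
Proof.
move=> A_gt0.
(* The successor form of the cardinal gives the ordinals the group structure of the integers modulo
   [#|A|]. *)
have [g [g' gK g'K]] : exists g : A -> 'I_(#|A|.-1.+1), bijective g.
  by rewrite prednK //; exists enum_rank; apply: enum_rank_bij.
exists (fun x => g' (\sum_(c in C) g (x c))) => x y c cC /(can_inj g'K).
rewrite (bigD1 c) //= [RHS](bigD1 c) //= => sumE xy.
apply: (can_inj gK); move: sumE.
rewrite (eq_bigr (fun d => g (y d))) => [|d /andP[dC dc]]; first exact: addIr.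
by rewrite xy.
Qed.

End Checksum.

(** * The program and its length *)

Section Program.

Variables (A : finType) (n : nat) (phi : 'I_n -> 'I_n).
Variable M : ('I_n -> A) -> A.

Hypothesis M_inj : forall x y c, c \in cycle_reps phi -> M x = M y ->
  (forall d, d \in cycle_reps phi -> d != c -> x d = y d) -> x c = y c.

Let input (x : (A ^ (n + 1))%type) (i : 'I_n) : A := x (lshift 1 i).

Definition state (S : {set 'I_n}) (x : (A ^ (n + 1))%type) : (A ^ (n + 1))%type :=
  [ffun k => match split k with
             | inl i => if i \in S then input x (phi i) else input x i
             | inr _ => M (input x)
             end].

Lemma state_lshift S x i :
  state S x (lshift 1 i) = if i \in S then input x (phi i) else input x i.
Proof. by rewrite ffunE (unsplitK (inl i)). Qed.

Lemma state_rshift S x i : state S x (rshift n i) = M (input x).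
Proof. by rewrite ffunE (unsplitK (inr i)). Qed.

(** Unless [phi i] is lost, some register still holds its value. If it is lost, it is a
    representative and no other one is lost, so the checksum yields the value. *)
Lemma state_determines S x y i :
  admissible phi S -> state S x = state S y -> input x (phi i) = input y (phi i).
Proof.
move=> [_ closedS lostS] /ffunP e.
have unlost j : ~~ lost phi S j -> input x j = input y j.
  rewrite negb_and => /orP[jS|].
    by have := e (lshift 1 j); rewrite !state_lshift (negPf jS).
  rewrite negb_forall => /existsP[k]; rewrite negb_imply negbK => /andP[kS /eqP <-].
  by have := e (lshift 1 k); rewrite !state_lshift kS.
have [lost_i|/unlost//] := boolP (lost phi S (phi i)).
have iC : phi i \in cycle_reps phi.
  case/andP: (lost_i) => iS /forall_inP noPre; apply/negPn/negP => iC.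
  by have /noPre := closedS _ i iS iC erefl; rewrite eqxx.
apply: M_inj => //; first by have := e (rshift n ord0); rewrite !state_rshift.
move=> d dC di; apply: unlost; apply: contra di => lost_d.
by apply/eqP; apply: lostS.
Qed.

Lemma program_from S :
  admissible phi S ->
  exists p : seq (transformation A (n + 1)),
    [/\ size p = #|moved phi :\: S|, all (@instruction A (n + 1)) p &
        forall x, run p (state S x) = state (moved phi) x].
Proof.
have [d] := ubnP #|moved phi :\: S|; elim: d S => // d IHd S /ltnSE le_d admS.
have [->|SNm] := eqVneq S (moved phi).
  by exists [::]; rewrite setDv cards0.
have [i iD admSi] := admissible_step admS SNm.
have cardD : #|moved phi :\: S| = #|moved phi :\: (i |: S)|.+1.
  by rewrite (cardsD1 i) iD setDDl setUC.
have [|p [sp ip rp]] := IHd (i |: S) _ admSi; first by rewrite -ltnS -cardD.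
have [|x y xy|g ig gE] := @exists_instruction A (n + 1) _ (state S) (state (i |: S))
  (lshift 1 i).
- move=> x j; rewrite -(splitK j); case: (split j) => k /= kNi; last by rewrite !state_rshift.
  rewrite !state_lshift in_setU1; case: eqVneq => //= ki.
  by rewrite ki eqxx in kNi.
- by rewrite !state_lshift setU11 (state_determines i admS xy).
- exists (g :: p); split=> /=; [by rewrite sp cardD | by rewrite ig | ].
  by move=> x; rewrite gE -rp.
Qed.

Lemma memory_complexity_manipulation :
  memory_complexity (manipulation A phi) 1 <= #|moved phi|.+1.
Proof.
pose h : transformation A (n + 1) := finfun (state (moved phi)).
have hext : h \in extensions (manipulation A phi) 1.
  rewrite inE; apply/forallP => x; apply/forallP => i.
  rewrite ffunE state_lshift !ffunE inE /input.
  by have [->|] := eqVneq (phi i) i.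
have [p []] := program_from (admissible0 phi); rewrite setD0 => sp ip rp.
(* The one extra instruction: it overwrites the arbitrary content of the memory cell with the
   checksum. *)
have [|x y ->//|g ig gE] :=
  @exists_instruction A (n + 1) _ id (state set0) (rshift n ord0).
  move=> x j; rewrite -(splitK j); case: (split j) => k /=; last by rewrite ord1 eqxx.
  by rewrite state_lshift inE.
apply: leq_trans (memory_complexity_le hext) _.
rewrite -sp.
apply: (@procedural_complexity_le _ _ (g :: p)); rewrite /computes /= ig ip /=.
by apply/forallP => x; rewrite gE rp ffunE.
Qed.

End Program.

Theorem proposition14 (A : finType) (hA : 2 <= #|A|) (n : nat) (hn : 2 <= n)
    (phi : 'I_n -> 'I_n) (F : nat) (hF : F = #|[set i | phi i == i]|) :
  memory_complexity (manipulation A phi) 1 <= n - F + 1.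
Proof.
have [M M_inj] := exists_checksum (cycle_reps phi) (ltnW hA).
have -> : n - F + 1 = #|moved phi|.+1.
  rewrite addn1 hF -[n in n - _]card_ord -(cardsC [set i | phi i == i]) addKn; congr _.+1.
  by apply: eq_card => i; rewrite !inE.
exact: memory_complexity_manipulation M_inj.
Qed.
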